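(* Let $G$ be a socle friendly finite group and let $\delta=\dim G$. Consider sequences of triples $(\mathcal{H}_i,T_i,\Delta_i)_{i\ge 0}$ produced by the greedy construction described in the context. Then: (1) For any choice of the subgroups $H_i$ in the construction, $T_{\delta-1}\neq\{1\}$ (when $\delta\ge 1$) whereas $T_\delta=\{1\}$. Furthermore, $\mathcal{H}_\delta$ is a minimal faithful collection of size $\delta$, and $\Delta_\delta=\Delta(G)$. (2) Conversely, up to $G$-isomorphism, any minimal faithful collection of $G$ of size $\delta$ can be obtained this way, i.e. as $\mathcal{H}_\delta$ for some choice of the subgroups $H_i$.
   Context: For a finite group $G$, $\mathcal{M}(G)$ is the set of minimal normal subgroups of $G$, the socle $M(G)$ is the subgroup they generate, and $\mathcal{T}(G)$ is the set of normal subgroups of $G$ contained in $M(G)$. Every $T\in\mathcal{T}(G)$ is an internal direct product of minimal normal subgroups of $G$, and the number of factors depends only on $(G,T)$; it is denoted $\dim_G T$, and $\dim G := \dim_G M(G)$. For a subgroup $H\le G$, $\operatorname{Core}_G(H)=\bigcap_{g\in G} g^{-1}Hg$ and $\operatorname{RC}_G(H)=\operatorname{Core}_G(H)\cap M(G)$. The group $G$ is called socle friendly if $\operatorname{RC}_G(H\cdot T)=\operatorname{RC}_G(H)\cdot T$ for every subgroup $H\le G$ and every $T\in\mathcal{T}(G)$. A collection is a set $\mathcal{H}$ of subgroups of $G$; $\operatorname{Core}_G(\mathcal{H})=\bigcap_{H\in\mathcal{H}}\operatorname{Core}_G(H)$ (equal to $G$ if $\mathcal{H}=\emptyset$). $\mathcal{H}$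 is faithful if $\operatorname{Core}_G(\mathcal{H})=\{1\}$, and it is a minimal faithful collection if moreover $\sum_{H\in\mathcal{H}}[G:H]$ is minimal among all faithful collections. Collections correspond to $G$-sets $\bigsqcup_{H\in\mathcal{H}}G/H$, and two collections are $G$-isomorphic if the corresponding $G$-sets are isomorphic (equivalently, they agree after replacing members by conjugates). $d(G)$ is the smallest size of a set on which $G$ acts faithfully ($d(\{1\})=0$), and $\Delta(G)=d(G)/|G|$. Greedy construction: put $\mathcal{H}_0=\emptyset$, $T_0=M(G)$, $\Delta_0=0$. Given $(\mathcal{H}_i,T_i,\Delta_i)$ with $T_i\ne\{1\}$, choose a subgroup $H_{i+1}$ of $G$ of maximal order among the subgroups of $G$ not containing $T_i$, and set $\mathcal{H}_{i+1}=\mathcal{H}_i\cup\{H_{i+1}\}$, $T_{i+1}=T_i\cap\operatorname{Core}_G(H_{i+1})$, $\Delta_{i+1}=\Delta_i+\frac{1}{|H_{i+1}|}$. If $T_i=\{1\}$, set $(\mathcal{H}_{i+1},T_{i+1},\Delta_{i+1})=(\mathcal{H}_i,T_i,\Delta_i)$. The sequence depends on the choices of the subgroups $H_i$. *)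

(* Defs.v *)
From HB Require Import structures.
From mathcomp Require Import all_boot all_order all_algebra all_fingroup.
From mathcomp Require Import all_solvable.
From mathcomp Require Import boolp.

Set Implicit Arguments.
Unset Strict Implicit.
Unset Printing Implicit Defensive.

Import GroupScope GRing.Theory Num.Theory.

Section Socle.

Variables (gT : finGroupType) (G : {group gT}).

Definition minimal_normals : {set {group gT}} :=
  [set M : {group gT} | (M \subset G) && minnormal M G].

Definition socle : {group gT} :=
  <<\bigcup_(M in minimal_normals) M>>%G.

Definition socle_normals : {set {group gT}} :=
  [set T : {group gT} | (T <| G) && (T \subset socle)].

Definition is_decomposition (T : {group gT}) (F : {set {group gT}}) : bool :=
  (F \subset minimal_normals) && (\big[dprod/1]_(M in F) M == T :> {set gT}).

(* The number of factors does not depend on the chosen decomposition, which    *)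
(* exists for every T in socle_normals; the value 0 on other T is junk.        *)
Definition dim_in (T : {group gT}) : nat :=
  if [pick F | is_decomposition T F] is Some F then #|F| else 0.

Definition group_dim : nat := dim_in socle.

(* Defined on sets so as to apply directly to the product H * T.               *)
Definition restricted_core (A : {set gT}) : {set gT} := gcore A G :&: socle.

Definition socle_friendly : Prop :=
  forall H T : {group gT}, H \subset G -> T \in socle_normals ->
    restricted_core (H * T) = restricted_core H * T.

End Socle.

Section Collections.

Variables (gT : finGroupType) (G : {group gT}).
Implicit Types (HH KK : {set {group gT}}).

Definition is_collection HH : bool := HH \subset subgroups G.

(* The factor G only matters when HH is empty.                                 *)
Definition collection_core HH : {set gT} :=
  G :&: \bigcap_(H in HH) gcore H G.

Definition faithful_collection HH : Prop :=
  is_collection HH /\ collection_core HH = 1.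

Definition collection_degree HH : nat := \sum_(H in HH) #|G : H|.

Definition minimal_faithful_collection HH : Prop :=
  faithful_collection HH /\
  forall KK, faithful_collection KK ->
    (collection_degree HH <= collection_degree KK)%N.

(* The disjoint union of the G / H for H in HH, with (H, C) standing for the   *)
(* left coset C in the summand G / H.                                          *)
Definition Gset HH : {set {group gT} * {set gT}} :=
  [set p | (p.1 \in HH) && (p.2 \in lcosets p.1 G)].

Definition Gset_act (g : gT) (p : {group gT} * {set gT}) :
  {group gT} * {set gT} := (p.1, g *: p.2).

Definition G_isomorphic HH KK : Prop :=
  exists f : {group gT} * {set gT} -> {group gT} * {set gT},
    [/\ {in Gset HH &, injective f},
        f @: Gset HH = Gset KK
      & {in G & Gset HH, forall g p, f (Gset_act g p) = Gset_act g (f p)}].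

End Collections.

Section MinimalDegree.

Variables (gT : finGroupType) (G : {group gT}).

Definition has_faithful_action (n : nat) : Prop :=
  exists (X : finType) (to : action G X),
    #|X| = n /\ [faithful G, on [set: X] | to].

Lemma ex_faithful_action : exists n, `[< has_faithful_action n >].
Proof.
exists #|gT|; apply/asboolP; exists gT, ('R \ subsetT G)%act; split=> //.
apply/subsetP=> x /setIP[Gx /astab_act/(_ (in_setT 1))].
by rewrite /= mul1g inE => ->.
Qed.

Definition min_degree : nat := ex_minn ex_faithful_action.

Definition relative_min_degree : rat := (min_degree%:R / #|G|%:R)%R.

End MinimalDegree.

Section Greedy.

Variables (gT : finGroupType) (G : {group gT}).

Record greedy_state := GreedyState {
  greedy_coll : {set {group gT}};
  greedy_top : {group gT};
  greedy_weight : rat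
}.

Definition greedy_choice (T H : {group gT}) : Prop :=
  [/\ H \subset G, ~~ (T \subset H)
    & forall K : {group gT}, K \subset G -> ~~ (T \subset K) ->
        (#|K| <= #|H|)%N].

Definition greedy_init : greedy_state := GreedyState set0 (socle G) 0%R.

Definition greedy_next (s : greedy_state) (H : {group gT}) : greedy_state :=
  GreedyState (H |: greedy_coll s)
              [group of greedy_top s :&: gcore H G]
              (greedy_weight s + #|H|%:R^-1)%R.

Definition greedy_step (s s' : greedy_state) : Prop :=
  if greedy_top s :==: 1 then s' = s
  else exists2 H : {group gT}, greedy_choice (greedy_top s) H
                             & s' = greedy_next s H.

Definition greedy_sequence (s : nat -> greedy_state) : Prop :=
  s 0 = greedy_init /\ forall i, greedy_step (s i) (s i.+1).

End Greedy.

(* Main.v *)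
Require Import Defs.
From HB Require Import structures.
From mathcomp Require Import all_boot all_order all_algebra all_fingroup.
From mathcomp Require Import all_solvable.
From mathcomp Require Import boolp.

Set Implicit Arguments.
Unset Strict Implicit.
Unset Printing Implicit Defensive.

Import GroupScope.

(**
  The normal subgroups of G inside the socle form a modular lattice in which
  every member is generated by minimal normal subgroups
  (socle_normal_generated).  Each such T therefore has a well-behaved height,
  which grows by exactly one when T is joined with a minimal normal subgroup
  outside it (height_joinN), and the height of the socle is dim G
  (group_dimE).

  Termination.  Let H have maximal order among the subgroups not containing T,
  and let N be a minimal normal subgroup inside T but not inside H.  Then H N
  is strictly larger than H, so it contains T; since G is socle friendly, the
  core of H N meets the socle in RC(H) N, and hence T = (T ∩ Core H) N.  So
  every greedy step lowers the height by exactly one (height_greedy), and the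
  construction reaches the trivial group after exactly dim G steps.

  Minimality.  This is a greedy exchange argument (greedy_exchange).  Suppose
  that the cores of the members of a list L meet T trivially, and put
  U = T ∩ Core H.  Intersect T and U with the cores of the members of L one
  after the other; the two chains start distinct and both end at 1, so they
  merge at some member K, where A ∩ Core K = U' ∩ Core K with U' < A the
  current terms.  If K contains U', it can be dropped from L, and it cost at
  least as much as H because it does not contain T.  Otherwise K is replaced
  by K N, where N is a minimal normal subgroup inside A but not inside U';
  this leaves the intersection with U' unchanged.  As K N does not contain T,
  |H| >= |K N| >= 2 |K|, so that 1/|H| + 1/|K N| <= 1/|K|.  In both cases H
  together with the new list is no more expensive than L.  Iterating, a greedy
  run is no more expensive than any faithful list.  The least degree of such a
  list is d(G): the stabilisers of orbit representatives turn a faithful action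
  into a faithful list, and coset spaces lead back
  (min_degree_minimal_faithful).

  Converse.  Sort a minimal faithful collection of size dim G by decreasing
  order; every member is then a legal greedy choice (sorted_greedy).
  If one were not, exchanging a larger H into the list would, in the dropping
  case, strictly lower the degree, and in the replacement case produce a
  minimal faithful list with dim G + 1 members; but the members of a minimal
  faithful list cut the socle down strictly one after the other, so there are
  at most dim G of them (faithful_or_height).
*)

(** * Normal subgroups inside the socle and their height *)

Section SocleLattice.

Variables (gT : finGroupType) (G : {group gT}).
Implicit Types (A B C M N T U X : {group gT}).

Lemma normal_minnormalI N X :
  minnormal N G -> G \subset 'N(X) -> ~~ (N \subset X) -> N :&: X = 1.
Proof.
case/mingroupP=> /andP[_ nNG] minN nXG nsNX; apply/eqP.
apply: contraR nsNX => ntNX.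
have /= <- := minN (N :&: X)%G; rewrite ?subsetIr ?subsetIl //=.
by rewrite ntNX normsI.
Qed.

Lemma normal_join_mul X N : X <| G -> N \subset G -> X <*> N = X * N.
Proof. by case/andP=> _ nXG sNG; rewrite norm_joinEr // (subset_trans sNG). Qed.

Lemma minimal_normalsP N :
  reflect (N <| G /\ minnormal N G) (N \in minimal_normals G).
Proof.
rewrite inE; apply: (iffP andP) => [[sNG mN] | [/andP[]]] //.
by split=> //; case/mingroupP: (mN) => /andP[_ nNG] _; apply/andP.
Qed.

Lemma normal_minnormal_exists X :
  X <| G -> X :!=: 1 -> exists2 N, N \in minimal_normals G & N \subset X.
Proof.
case/andP=> sXG nXG ntX; have [N mN sNX] := minnormal_exists ntX nXG.
by exists N => //; rewrite inE mN (subset_trans sNX).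
Qed.

Lemma minimal_normal_sub_socle N : N \in minimal_normals G -> N \subset socle G.
Proof. by move=> mN; rewrite sub_gen // (bigcup_max N). Qed.

Lemma socle_sub X :
  (forall N, N \in minimal_normals G -> N \subset X) -> socle G \subset X.
Proof. by move=> sNX; rewrite gen_subG; apply/bigcupsP. Qed.

Lemma gen_minimal_normals_normal (F : {set {group gT}}) :
  F \subset minimal_normals G -> <<\bigcup_(N in F) N>> <| G.
Proof.
move/subsetP=> sF; rewrite /normal gen_subG; apply/andP; split.
  by apply/bigcupsP=> N /sF/minimal_normalsP[/normal_sub].
apply/norms_gen/norms_bigcup/bigcapsP=> N /sF/minimal_normalsP[nsN _].
exact: normal_norm.
Qed.

Lemma socle_normal : socle G <| G.
Proof. exact: gen_minimal_normals_normal. Qed.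

Lemma socle_normalsP T :
  reflect (T <| G /\ T \subset socle G) (T \in socle_normals G).
Proof. by rewrite inE; apply: andP. Qed.

Lemma socle_in_socle_normals : socle G \in socle_normals G.
Proof. by rewrite inE socle_normal /=. Qed.

Lemma minimal_normal_socle_normals N :
  N \in minimal_normals G -> N \in socle_normals G.
Proof.
move=> mN; apply/socle_normalsP; split; last exact: minimal_normal_sub_socle.
by case/minimal_normalsP: mN.
Qed.

Lemma normal_socleI1 X : X <| G -> socle G :&: X = 1 -> X :=: 1.
Proof.
move=> nsX tiX; apply/eqP; apply: contraT => ntX.
have [N mN sNX] := normal_minnormal_exists nsX ntX.
have : N \subset socle G :&: X by rewrite subsetI minimal_normal_sub_socle.
rewrite tiX; case/minimal_normalsP: mN => _ /mingroupP[/andP[ntN _] _].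
by rewrite subG1 (negPf ntN).
Qed.

(** Take C maximal among the normal subgroups of G that avoid B: a minimal
    normal N outside B C could be added to C, because N avoids B C. *)
Lemma socle_complement B : B <| G ->
  exists C, [/\ C <| G, B :&: C = 1 & socle G \subset B * C].
Proof.
move=> nsB.
pose P := [pred C : {group gT} | (C <| G) && (B :&: C == 1)].
have P1: P 1%G by rewrite /= normal1 setIg1 eqxx.
have [C /maxgroupP[/andP[nsC /eqP tiBC] maxC] _] := maxgroup_exists P1.
exists C; split=> //.
have nsBC: B <*> C <| G by rewrite normalY.
rewrite -(normal_join_mul nsB (normal_sub nsC)); apply: socle_sub => N.
case/minimal_normalsP=> nsN mN; apply: contraT => nsNBC.
have tiN := normal_minnormalI mN (normal_norm nsBC) nsNBC.
case/negP: (nsNBC); apply: subset_trans (joing_subr B C).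
have defCN : C <*> N = C * N by rewrite normal_join_mul ?normal_sub.
rewrite -(maxC (C <*> N)%G) ?joing_subl ?joing_subr //= normalY //=.
rewrite eqEsubset sub1G andbT defCN.
apply/subsetP=> x /setIP[Bx /mulsgP[c n Cc Nn def_x]].
have n1: n \in (1 : {set gT}).
  rewrite -tiN inE Nn -(mulKg c n) -def_x groupM ?groupV //.
    exact: subsetP (joing_subr B C) c Cc.
  exact: subsetP (joing_subl B C) x Bx.
by rewrite -tiBC inE Bx def_x (set1P n1) mulg1.
Qed.

(** Complete reducibility: if B is generated by the minimal normal subgroups
    inside A and C is a complement of B, then A = B (A ∩ C) by the modular law,
    and A ∩ C is trivial since a minimal normal subgroup in it would lie in
    both B and C. *)
Lemma socle_normal_generated A X : A \in socle_normals G ->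
  (forall N, N \in minimal_normals G -> N \subset A -> N \subset X) ->
  A \subset X.
Proof.
case/socle_normalsP=> nsA sAS sNX.
pose F := [set N in minimal_normals G | N \subset A].
pose B := <<\bigcup_(N in F) N>>%G.
have inF N : (N \in F) = (N \in minimal_normals G) && (N \subset A) by rewrite inE.
have sBA: B \subset A by rewrite gen_subG; apply/bigcupsP=> N; rewrite inF => /andP[].
have sBX: B \subset X.
  by rewrite gen_subG; apply/bigcupsP=> N; rewrite inF => /andP[]; apply: sNX.
have nsB: B <| G.
  by apply: gen_minimal_normals_normal; apply/subsetP=> N; rewrite inF => /andP[].
have [C [nsC tiBC sSBC]] := socle_complement nsB.
have nsAC: A :&: C <| G by rewrite normalI.
have tiAC: A :&: C = 1.
  apply/eqP; apply: contraT => ntAC.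
  have [N mN] := @normal_minnormal_exists (A :&: C)%G nsAC ntAC.
  rewrite /= subsetI => /andP[sNA sNC].
  have: N \subset B :&: C.
    by rewrite subsetI sNC andbT sub_gen // (bigcup_max N) // inF mN.
  rewrite tiBC; case/minimal_normalsP: mN => _ /mingroupP[/andP[ntN _] _].
  by rewrite subG1 (negPf ntN).
apply: subset_trans sBX; rewrite -(mulg1 B) -tiAC [A :&: C]setIC.
by rewrite group_modl // subsetI subxx andbT (subset_trans sAS).
Qed.

Lemma minimal_normal_not_sub A X : A \in socle_normals G -> ~~ (A \subset X) ->
  exists2 N, N \in minimal_normals G & (N \subset A) && ~~ (N \subset X).
Proof.
move=> sA nsAX; apply/exists_inP; apply: contraR nsAX => /exists_inPn noN.
apply: socle_normal_generated sA _ => N mN sNA.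
by have := noN N mN; rewrite sNA negbK.
Qed.

(** The modular law gives X = T (X ∩ N), and X ∩ N is 1 or N. *)
Lemma joinN_minimal T N X : T <| G -> N \in minimal_normals G ->
  X <| G -> T \subset X -> X \subset T <*> N -> ~~ (X \subset T) ->
  X :=: T <*> N.
Proof.
move=> nsT /minimal_normalsP[nsN mN] nsX sTX sXTN nsXT.
have defTN := normal_join_mul nsT (normal_sub nsN).
apply/eqP; rewrite eqEsubset sXTN join_subG sTX /=; apply: contraT => nsNX.
have tiNX := normal_minnormalI mN (normal_norm nsX) nsNX.
case/negP: nsXT; rewrite -[T : {set _}]mulg1 -tiNX group_modl // subsetI subxx andbT.
by rewrite -defTN.
Qed.

(** Length of the longest strict chain of normal subgroups of G inside the
    socle that descends from T, with n as recursion fuel: a bound on the order of T suffices because orders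
    drop along such a chain. *)
Fixpoint height_upto n T : nat :=
  if n is n'.+1 then
    \max_(U in socle_normals G | U \proper T) (height_upto n' U).+1
  else 0.

Definition height T : nat := height_upto #|T| T.

Lemma height_upto_stable m n T :
  (#|T| <= m)%N -> (#|T| <= n)%N -> height_upto m T = height_upto n T.
Proof.
elim: m n T => [|m IHm] [|n] T; rewrite ?leqn0 ?gtn_eqF ?cardG_gt0 // => leTm leTn /=.
apply: eq_bigr => U /andP[_ /proper_card ltUT].
by rewrite (IHm n) // -ltnS (leq_trans ltUT).
Qed.

Lemma heightE T :
  height T = \max_(U in socle_normals G | U \proper T) (height U).+1.
Proof.
rewrite /height -{1}(prednK (cardG_gt0 T)) /=; apply: eq_bigr => U /andP[_ sUT].
by congr _.+1; apply: height_upto_stable => //; rewrite -ltnS prednK // proper_card.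
Qed.

Lemma height_proper U T :
  U \in socle_normals G -> U \proper T -> (height U < height T)%N.
Proof. by move=> sU sUT; rewrite (heightE T) (bigD1 U) ?sU // leq_maxl. Qed.

Lemma height_eq T U : T :=: U -> height T = height U.
Proof. by move/group_inj->. Qed.

Lemma height1 : height 1%G = 0.
Proof.
by rewrite heightE big_pred0 // => U; rewrite properE sub1G !andbF.
Qed.

Lemma height_eq0 T : T \in socle_normals G -> (height T == 0) = (T :==: 1).
Proof.
move=> sT; apply/eqP/eqP => [h0 | /(@height_eq _ 1%G)->]; last exact: height1.
apply/eqP; apply: contraT => ntT.
have s1: 1%G \in socle_normals G by rewrite inE normal1 sub1G.
by have := height_proper s1 (etrans (proper1G T) ntT); rewrite h0.
Qed.

Lemma socle_normalsI T U : T \in socle_normals G -> U <| G ->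
  (T :&: U)%G \in socle_normals G.
Proof.
case/socle_normalsP=> nsT sTS nsU; apply/socle_normalsP; rewrite normalI //=.
by rewrite (subset_trans (subsetIl _ _)).
Qed.

Lemma socle_normalsY T U : T \in socle_normals G -> U \in socle_normals G ->
  (T <*> U)%G \in socle_normals G.
Proof.
case/socle_normalsP=> nsT sTS /socle_normalsP[nsU sUS].
by apply/socle_normalsP; rewrite normalY //= join_subG sTS.
Qed.

(** A proper normal U < T N has height at most that of T, by induction on the
    order of T N: if U is not inside T, pick a minimal normal N1 in U but not in
    T; then T N1 = T N and U = (U ∩ T) N1 with U ∩ T < T. *)
Lemma height_joinN T N : T \in socle_normals G -> N \in minimal_normals G ->
  ~~ (N \subset T) -> height (T <*> N) = (height T).+1.
Proof.
move: {2}_.+1 (ltnSn #|T <*> N|) => n; elim: n T N => // n IHn T N.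
rewrite ltnS => leTNn sT mN nsNT; have [nsT sTS] := socle_normalsP _ sT.
have [nsN _] := minimal_normalsP _ mN.
have pTN: T \proper T <*> N.
  by rewrite properE joing_subl join_subG subxx /=.
apply/eqP; rewrite eqn_leq height_proper // andbT heightE.
apply/bigmax_leqP=> U /andP[sU pUTN]; rewrite ltnS.
have [nsU sUS] := socle_normalsP _ sU.
have [sUT | nsUT] := boolP (U \subset T).
  have [sTU | nsTU] := boolP (T \subset U).
    by rewrite (@height_eq U T) //; apply/eqP; rewrite eqEsubset sUT.
  by rewrite ltnW // height_proper // properE sUT.
have [N1 mN1 /andP[sN1U nsN1T]] := minimal_normal_not_sub sU nsUT.
have [nsN1 _] := minimal_normalsP _ mN1.
have defTN: T <*> N1 = T <*> N.
  apply: (@joinN_minimal T N (T <*> N1)%G) => //=; rewrite ?normalY ?joing_subl //.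
    by rewrite join_subG joing_subl (subset_trans sN1U) ?proper_sub.
  by rewrite join_subG subxx.
have sUIT : (U :&: T)%G \in socle_normals G by apply: socle_normalsI.
have defU: (U :&: T) <*> N1 = U.
  rewrite (@normal_join_mul (U :&: T)%G) ?normalI ?normal_sub //= group_modr //.
  rewrite -(normal_join_mul nsT (normal_sub nsN1)) defTN.
  by apply/setIidPl/proper_sub.
have nsTU: ~~ (T \subset U).
  by apply: contraL pUTN => sTU; rewrite properE /= -defTN join_subG sTU sN1U andbF.
rewrite -(@height_eq ((U :&: T) <*> N1)%G U) // IHn ?height_proper //.
- by rewrite properE subsetIr subsetI subxx andbT.
- rewrite /= defU; exact: leq_trans (proper_card pUTN) leTNn.
by rewrite subsetI sN1U.
Qed.

(** Multiplying the factors one at a time raises the height by one each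
    time. *)
Lemma height_dprod (F : {set {group gT}}) (P : {group gT}) :
    F \subset minimal_normals G -> \big[dprod/1]_(M in F) M = P ->
  P \in socle_normals G /\ height P = #|F|.
Proof.
move: {2}_.+1 (ltnSn #|F|) => n; elim: n F P => // n IHn F P leFn sF.
have [-> | [N FN]] := set_0Vmem F.
  rewrite big_set0 cards0 => P1; rewrite -(@height_eq 1%G) // height1; split=> //.
  by rewrite -(@group_inj _ 1%G P) // inE normal1 sub1G.
rewrite (cardsD1 N) FN in leFn *.
rewrite (big_setD1 N) //= => /dprodP[[_ Q _ defQ] defP _ tiNQ].
rewrite defQ in defP tiNQ.
have mN := subsetP sF N FN; have [nsN /mingroupP[/andP[ntN _] _]] := minimal_normalsP _ mN.
have [sQ hQ] := IHn _ Q leFn (subset_trans (subsetDl _ _) sF) defQ.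
have [nsQ _] := socle_normalsP _ sQ.
have defP' : (Q <*> N)%G = P.
  apply: group_inj; rewrite /= joingC -defP.
  by apply: (normal_join_mul nsN (normal_sub nsQ)).
rewrite -defP' height_joinN //; last first.
  by apply: contra ntN => sNQ; rewrite -subG1 -tiNQ subsetI subxx.
split; last by rewrite hQ.
by apply: socle_normalsY => //; apply: minimal_normal_socle_normals.
Qed.

(** A set of minimal normal subgroups that is maximal among those with a direct
    product generates the socle: any N outside the product avoids it and hence
    commutes with it. *)
Lemma socle_decomposition :
  exists F : {set {group gT}}, is_decomposition G (socle G) F.
Proof.
pose P (F : {set {group gT}}) := (F \subset minimal_normals G)
  && [exists H : {group gT}, \big[dprod/1]_(M in F) M == H :> {set gT}].
have P0: P set0.
  by rewrite /P sub0set big_set0; apply/existsP; exists 1%G.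
have [F /maxsetP[/andP[sF /existsP[H /eqP defH]] maxF] _] := maxset_exists P0.
exists F; rewrite /is_decomposition sF defH /=.
have [/socle_normalsP[nsH sHS] _] := height_dprod sF defH.
rewrite eqEsubset sHS; apply: socle_sub => N mN; apply: contraT => nsNH.
have [nsN mmN] := minimal_normalsP _ mN.
have tiNH := normal_minnormalI mmN (normal_norm nsH) nsNH.
have cNH: H \subset 'C(N).
  apply/commG1P/trivgP; rewrite -tiNH setIC commg_subI // subsetI subxx.
    exact: subset_trans (normal_sub nsH) (normal_norm nsN).
  exact: subset_trans (normal_sub nsN) (normal_norm nsH).
have nFN: N \notin F.
  apply: contra nsNH => FN; rewrite -(bigdprodWY defH) sub_gen //.
  by rewrite (bigcup_max N).
case/negP: (nFN); rewrite -(maxF (N |: F)) ?setU11 ?subsetUr //.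
rewrite /P subUset sub1set mN sF; apply/existsP; exists (N <*> H)%G.
by rewrite big_setU1 //= defH dprodEY.
Qed.

Lemma group_dimE : group_dim G = height (socle G).
Proof.
rewrite /group_dim /dim_in; case: pickP => [F /andP[sF /eqP defS] | noF].
  by have [_ ->] := height_dprod sF defS.
by have [F] := socle_decomposition; rewrite noF.
Qed.

End SocleLattice.

(** * Socle friendliness and the exchange argument *)

Section Exchange.

Variables (gT : finGroupType) (G : {group gT}).
Implicit Types (A H K M N T U X : {group gT}) (L : seq {group gT}).

(** Collections are handled as lists: an exchange may create repetitions, and
    the processing order matters. *)
Definition seq_degree L : nat := \sum_(K <- L) #|G : K|.

Definition seq_core L : {set gT} := \bigcap_(K <- L) gcore K G.

(** For T the socle this is faithfulness of the collection; the greedy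
    argument needs it relative to every T reached on the way. *)
Definition seq_faithful T L : bool :=
  all (fun K => K \subset G) L && (T :&: seq_core L == 1).

Lemma seq_core_cons K L : seq_core (K :: L) = gcore K G :&: seq_core L.
Proof. by rewrite /seq_core big_cons. Qed.

Lemma group_set_seq_core L : group_set (seq_core L).
Proof.
elim: L => [|K L IHL]; first by rewrite /seq_core big_nil groupP.
rewrite seq_core_cons; exact: (groupP (gcore K G :&: group IHL)).
Qed.

Canonical seq_core_group L := Group (group_set_seq_core L).

Lemma seq_core_cat L1 L2 : seq_core (L1 ++ L2) = seq_core L1 :&: seq_core L2.
Proof. by rewrite /seq_core big_cat. Qed.

Lemma seq_degree_cons K L : seq_degree (K :: L) = (#|G : K| + seq_degree L)%N.
Proof. by rewrite /seq_degree big_cons. Qed.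

Lemma seq_degree_cat L1 L2 :
  seq_degree (L1 ++ L2) = (seq_degree L1 + seq_degree L2)%N.
Proof. by rewrite /seq_degree big_cat. Qed.

Lemma seq_faithful_cons T K L :
  seq_faithful T (K :: L) =
    (K \subset G) && seq_faithful (T :&: gcore K G)%G L.
Proof. by rewrite /seq_faithful seq_core_cons setIA /= andbA. Qed.

Lemma subset_gcore T K : T <| G -> (T \subset gcore K G) = (T \subset K).
Proof.
case/andP=> _ nTG; apply/idP/idP => [sTc | sTK]; last exact: gcore_max.
exact: subset_trans sTc (gcore_sub _ _).
Qed.

Lemma capI_gcore T K : T <| G -> T \subset K -> T :&: gcore K G = T.
Proof. by move=> nsT sTK; apply/setIidPl; rewrite subset_gcore. Qed.

Lemma leq_index H K : H \subset G -> K \subset G ->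
  (#|K| <= #|H|)%N = (#|G : H| <= #|G : K|)%N.
Proof.
move=> sHG sKG; apply/idP/idP => [leKH | leiHK].
  by rewrite -!divgS // leq_div2l ?cardG_gt0.
have := leq_mul (leqnn #|H|) leiHK; rewrite Lagrange // -(Lagrange sKG).
by rewrite leq_pmul2r ?indexg_gt0.
Qed.

(** If no member can be dropped, each successive core strictly lowers the
    height of the intersection, which starts at T. *)
Lemma faithful_or_height T L : T \in socle_normals G -> seq_faithful T L ->
    (size L <= height G T)%N
  \/ exists2 L', seq_faithful T L' & (seq_degree L' < seq_degree L)%N.
Proof.
elim: L T => [|K L IHL] T sT; first by left.
rewrite seq_faithful_cons => /andP[sKG fL]; have [nsT _] := socle_normalsP _ _ sT.
have [sTK | nsTK] := boolP (T \subset K).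
  right; exists L; last by rewrite seq_degree_cons -add1n leq_add2r indexg_gt0.
  by move: fL; rewrite /seq_faithful /= capI_gcore.
have sTI : (T :&: gcore K G)%G \in socle_normals G.
  by rewrite socle_normalsI ?gcore_normal.
case: (IHL _ sTI fL) => [leL | [L' fL' ltL']].
  left; apply: leq_ltn_trans leL (height_proper _ _) => //.
  by rewrite properE subsetIl subsetI subxx subset_gcore.
right; exists (K :: L'); first by rewrite seq_faithful_cons sKG.
by rewrite !seq_degree_cons ltn_add2l.
Qed.

Hypothesis friendlyG : socle_friendly G.

Lemma join_normal_mul K N : K \subset G -> N <| G -> K <*> N = K * N.
Proof.
by move=> sKG /andP[_ nNG]; rewrite norm_joinEl // (subset_trans sKG).
Qed.

Lemma gcore_joinN K N : K \subset G -> N \in minimal_normals G ->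
  gcore (K <*> N) G :&: socle G = (gcore K G :&: socle G) * N.
Proof.
move=> sKG mN; have [nsN _] := minimal_normalsP _ _ mN.
by rewrite join_normal_mul //; apply: friendlyG; rewrite ?minimal_normal_socle_normals.
Qed.

(** For N a minimal normal subgroup in T but not in H, maximality of H forces
    T into H N, and socle friendliness then gives T = (T ∩ Core H) N. *)
Lemma height_greedy T H : T \in socle_normals G -> greedy_choice G T H ->
  height G T = (height G (T :&: gcore H G)).+1.
Proof.
move=> sT [sHG nsTH maxH]; have [nsT sTS] := socle_normalsP _ _ sT.
have [N mN /andP[sNT nsNH]] := minimal_normal_not_sub sT nsTH.
have [nsN _] := minimal_normalsP _ _ mN.
have sHNG : H <*> N \subset G by rewrite join_subG sHG normal_sub.
(* If not, H N would be a larger subgroup not containing T. *)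
have sTHN : T \subset H <*> N.
  apply: contraT => nsTHN; have := maxH (H <*> N)%G sHNG nsTHN.
  rewrite leqNgt proper_card // properE joing_subl join_subG subxx.
  by rewrite nsNH.
have nscH := gcore_normal sHG.
have defT : (T :&: gcore H G) <*> N = T.
  rewrite (@normal_join_mul _ G (T :&: gcore H G)%G) ?normalI ?normal_sub //.
  rewrite /= group_modr //; apply/setIidPl.
  apply: (@subset_trans _ _ (gcore (H <*> N) G :&: socle G)).
    by rewrite subsetI sTS (@subset_gcore T (H <*> N)%G) ?sTHN.
  by rewrite gcore_joinN // mulSg ?subsetIl.
rewrite -(@height_eq _ G ((T :&: gcore H G) <*> N)%G T) // height_joinN //.
  exact: socle_normalsI.
by rewrite subsetI sNT /= subset_gcore.
Qed.

(** By socle friendliness an element of A' ∩ Core (K N) is a product r n with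
    r in Core K and n in N.  Since n lies in A, so does r, which therefore lies
    in A'; hence n is in A' ∩ N = 1. *)
Lemma cap_gcore_join A A' K N : A \in socle_normals G -> A' <| G ->
    A' \subset A -> K \subset G -> N \in minimal_normals G -> N \subset A ->
    ~~ (N \subset A') -> A :&: gcore K G = A' :&: gcore K G ->
  A' :&: gcore (K <*> N) G = A' :&: gcore K G.
Proof.
case/socle_normalsP=> nsA sAS nsA' sA'A sKG mN sNA nsNA' capE.
have [nsN mmN] := minimal_normalsP _ _ mN.
apply/eqP; rewrite eqEsubset [X in _ && X]setIS ?andbT; last first.
  by rewrite gcore_max ?gcore_norm ?(subset_trans (gcore_sub _ _)) ?joing_subl.
apply/subsetP=> x /setIP[A'x cx]; rewrite inE A'x /=.
have /mulsgP[r n /setIP[cr _] Nn def_x]: x \in (gcore K G :&: socle G) * N.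
  by rewrite -gcore_joinN // inE cx (subsetP sAS) // (subsetP sA'A).
have A'r : r \in A'.
  have: r \in A :&: gcore K G.
    rewrite inE cr andbT -(mulgK n r) -def_x.
    by rewrite groupM ?groupV ?(subsetP sNA n) ?(subsetP sA'A x).
  by rewrite capE => /setIP[].
have n1 : n \in (1 : {set gT}).
  rewrite -(normal_minnormalI mmN (normal_norm nsA') nsNA') inE Nn.
  by rewrite -(mulKg r n) -def_x groupM ?groupV.
by rewrite def_x (set1P n1) mulg1.
Qed.

(** How an exchange paid for H: by dropping a member K that does not contain
    T, or with as many members as before and at no extra cost.  The first case
    records the exact cost of K, so that a strict gain can be read off when H
    is strictly larger than K; the second keeps the size, so that the list with
    H added becomes longer. *)
Definition exchange_result T H L L' :=
     (exists2 K, (K \in L) && ~~ (T \subset K)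
        & seq_degree L = (#|G : K| + seq_degree L')%N)
  \/ size L' = size L /\ (#|G : H| + seq_degree L' <= seq_degree L)%N.

(** The induction walks along L until A and U have the same intersection with
    Core K, and modifies the list there. *)
Lemma greedy_exchange_cap T H A U L :
    greedy_choice G T H -> A \in socle_normals G -> A \subset T ->
    U <| G -> U \proper A -> seq_faithful A L ->
  exists2 L', seq_faithful U L' & exchange_result T H L L'.
Proof.
move=> [sHG nsTH maxH]; elim: L A U => [|K L IHL] A U sA sAT nsU pUA.
  case/andP=> _; rewrite /seq_core big_nil setIT => /eqP A1.
  by move: pUA; rewrite A1 properE sub1G andbF.
rewrite seq_faithful_cons => /andP[sKG fL].
have [nsA sAS] := socle_normalsP _ _ sA; have sUA := proper_sub pUA.
have nscK := gcore_normal sKG.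
have [capE | capN] := eqVneq (A :&: gcore K G) (U :&: gcore K G); last first.
  have pI : (U :&: gcore K G)%G \proper (A :&: gcore K G)%G.
    by rewrite properEneq eq_sym capN setSI.
  have [||L' fL' ex] := IHL _ _ (socle_normalsI sA nscK) _ _ pI fL.
  - by rewrite (subset_trans (subsetIl _ _)).
  - by rewrite normalI.
  exists (K :: L'); first by rewrite seq_faithful_cons sKG.
  case: ex => [[K1 /andP[LK1 nsTK1] degL] | [eq_size degL]].
    left; exists K1; first by rewrite inE LK1 orbT.
    by rewrite !seq_degree_cons degL addnCA.
  by right; rewrite /= eq_size !seq_degree_cons addnCA leq_add2l.
have [sUK | nsUK] := boolP (U \subset K).
  exists L; first by move: fL; rewrite /seq_faithful /= capE capI_gcore.
  left; exists K; rewrite ?seq_degree_cons ?mem_head //=.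
  apply: contra (proper_subn pUA) => sTK.
  by rewrite -(capI_gcore nsU sUK) -capE capI_gcore // (subset_trans sAT).
have [N mN /andP[sNA nsNU]] := minimal_normal_not_sub sA (proper_subn pUA).
have [nsN mmN] := minimal_normalsP _ _ mN.
have capKN := cap_gcore_join sA nsU sUA sKG mN sNA nsNU capE.
have sKNG : K <*> N \subset G by rewrite join_subG sKG normal_sub.
exists ((K <*> N)%G :: L).
  rewrite seq_faithful_cons sKNG /=; move: fL.
  by rewrite /seq_faithful /= capE capKN.
right; split=> //; rewrite !seq_degree_cons addnA leq_add2r.
have nsNK : ~~ (N \subset K).
  rewrite -subset_gcore //; apply: contra nsNU => sNcK.
  by apply: subset_trans (subsetIl U (gcore K G)); rewrite -capE subsetI sNA.
(* Otherwise U = U ∩ Core (K N) = U ∩ Core K would lie in K. *)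
have nsTKN : ~~ (T \subset K <*> N).
  apply: contra nsUK => sTKN.
  have sUcKN : U \subset gcore (K <*> N) G.
    by rewrite (@subset_gcore U (K <*> N)%G) // (subset_trans sUA) ?(subset_trans sAT).
  rewrite -subset_gcore //; apply/setIidPl; rewrite -capKN; exact/setIidPl.
have leKNH := maxH (K <*> N)%G sKNG nsTKN.
have leHKN : (#|G : H| <= #|G : K <*> N|)%N by rewrite -leq_index.
rewrite -(Lagrange_index sKNG (joing_subl K N)).
(* As N is not inside K, the index |K N : K| is at least 2. *)
apply: leq_trans (leq_mul (leqnn _) (_ : 2 <= _)%N); last first.
  by rewrite indexg_gt1 join_subG subxx.
by rewrite muln2 -addnn leq_add2r.
Qed.

Lemma greedy_exchange T H L :
    T \in socle_normals G -> greedy_choice G T H -> seq_faithful T L ->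
  exists2 L', seq_faithful (T :&: gcore H G)%G L'
    & exchange_result T H L L'.
Proof.
move=> sT gH fL; have [sHG nsTH _] := gH; have [nsT _] := socle_normalsP _ _ sT.
apply: (greedy_exchange_cap gH sT) => //; first by rewrite normalI ?gcore_normal.
by rewrite properE subsetIl subsetI subxx subset_gcore.
Qed.

End Exchange.

(** * Faithful collections and faithful actions *)

Section Degrees.

Variables (gT : finGroupType) (G : {group gT}).
Implicit Types (H K : {group gT}) (L : seq {group gT}) (HH : {set {group gT}}).

Lemma seq_coreP L x :
  reflect (forall K, K \in L -> x \in gcore K G) (x \in seq_core G L).
Proof.
elim: L => [|K L IHL]; first by rewrite /seq_core big_nil inE; constructor.
rewrite seq_core_cons inE; apply: (iffP andP) => [[cx /IHL cLx] K1 | cx].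
  by rewrite inE => /predU1P[->|/cLx].
split; first by rewrite cx ?mem_head.
by apply/IHL=> K1 LK1; rewrite cx // inE LK1 orbT.
Qed.

Lemma seq_core_set L HH : L =i HH -> seq_core G L = \bigcap_(H in HH) gcore H G.
Proof.
move=> eqL; apply/setP=> x; apply/seq_coreP/bigcapP => cx K.
  by rewrite -eqL; apply: cx.
by rewrite eqL; apply: cx.
Qed.

Lemma normal_seq_core L : all (fun K => K \subset G) L -> G :&: seq_core G L <| G.
Proof.
elim: L => [|K L IHL] /=; first by rewrite /seq_core big_nil setIT.
case/andP=> sKG /IHL nsL.
by rewrite seq_core_cons setICA normalI ?gcore_normal.
Qed.

(** A nontrivial normal subgroup meets the socle, so a core is trivial as soon
    as its intersection with the socle is. *)
Lemma faithful_collection_set L HH :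
  L =i HH -> faithful_collection G HH <-> seq_faithful G (socle G) L.
Proof.
move=> eqL; rewrite /faithful_collection /collection_core -(seq_core_set eqL).
have -> : is_collection G HH = all (fun K => K \subset G) L.
  apply/subsetP/allP => sG K; first by rewrite eqL => /sG; rewrite inE.
  by rewrite -eqL => /sG; rewrite inE.
have sSG := normal_sub (socle_normal G).
split=> [[sLG tiL] | /andP[sLG /eqP tiL]].
  by rewrite /seq_faithful sLG -subG1 -tiL setSI.
split=> //; have nsL := normal_seq_core sLG.
apply: (@normal_socleI1 _ G (G :&: seq_core G L)%G nsL).
by rewrite /= setIA (setIidPl sSG).
Qed.

Lemma seq_degree_enum HH : seq_degree G (enum HH) = collection_degree G HH.
Proof. by rewrite /seq_degree big_enum. Qed.

Lemma collection_degree_set L :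
  (collection_degree G [set K in L] <= seq_degree G L)%N.
Proof.
elim: L => [|K L IHL].
  by rewrite /collection_degree big_pred0 // => K; rewrite !inE.
rewrite seq_degree_cons set_cons; have [LK | L'K] := boolP (K \in [set K in L]).
  rewrite (setUidPr _) ?sub1set //; exact: leq_trans IHL (leq_addl _ _).
by rewrite /collection_degree big_setU1 //= leq_add2l.
Qed.

(** An arbitrary list competes through its underlying set, which is as faithful
    and no more expensive. *)
Lemma minimal_faithful_collectionP L HH : L =i HH -> uniq L ->
  minimal_faithful_collection G HH <->
  seq_faithful G (socle G) L /\
    forall L', seq_faithful G (socle G) L' -> (seq_degree G L <= seq_degree G L')%N.
Proof.
move=> eqL uL.
have -> : seq_degree G L = collection_degree G HH.
  rewrite -seq_degree_enum /seq_degree; apply: perm_big.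
  by apply: uniq_perm; rewrite ?enum_uniq // => K; rewrite mem_enum eqL.
rewrite /minimal_faithful_collection (faithful_collection_set eqL).
split=> -[fL minL]; split=> //.
  move=> L' fL'; apply: leq_trans (collection_degree_set L'); apply: minL.
  by apply/(@faithful_collection_set L') => // K; rewrite inE.
move=> KK /(@faithful_collection_set (enum KK)) fKK.
by rewrite -(seq_degree_enum KK) minL // fKK // => K; rewrite mem_enum.
Qed.

(** Take one point stabiliser per orbit: the orbit sizes are the indices, and
    an element in the core of a stabiliser fixes the whole orbit. *)
Lemma stabilizers_faithful (X : finType) (to : action G X) :
  [faithful G, on [set: X] | to] ->
  exists2 L, seq_faithful G (socle G) L & seq_degree G L = #|X|.
Proof.
move=> faithG.
have actsG : [acts G, on [set: X] | to].
  by apply/subsetP=> x Gx; rewrite inE Gx inE; apply/subsetP=> y _; rewrite !inE.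
have [_ _ injY XP] := orbit_transversalP actsG.
set Y := orbit_transversal to G [set: X] in injY XP.
exists [seq ('C_G[x | to])%G | x <- enum Y].
  apply/andP; split; first by apply/allP=> _ /mapP[x _ ->]; apply: subsetIl.
  rewrite -subG1; apply: subset_trans faithG; apply/subsetP=> g.
  case/setIP=> /(subsetP (normal_sub (socle_normal G))) Gg /seq_coreP cg.
  rewrite inE Gg inE Gg inE; apply/subsetP=> x _; rewrite inE; apply/eqP.
  have [a Ga Yax] := XP x (in_setT x).
  have: g \in gcore 'C_G[to x a | to] G.
    by apply: (cg ('C_G[to x a | to])%G); apply: map_f; rewrite mem_enum.
  rewrite -(memJ_norm _ (subsetP (gcore_norm _ _) a Ga)).
  move/(subsetP (gcore_sub _ _))/setIP=> [_ /astab_act/(_ (set11 _))].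
  rewrite -actMin ?groupJ // -conjgC.
  rewrite actMin //; exact: act_inj.
have orbE : orbit to G @: Y = orbit to G @: [set: X].
  apply/setP=> T; apply/imsetP/imsetP=> [[x _ ->] | [x _ ->]].
    by exists x; rewrite ?inE.
  have [a Ga Yax] := XP x (in_setT x); exists (to x a) => //.
  by apply/esym/orbit_in_eqP => //; apply: mem_orbit.
rewrite -cardsT -(acts_sum_card_orbit actsG) -orbE big_imset /=.
  by rewrite /seq_degree big_map big_enum /=; apply: eq_bigr => x _; rewrite card_orbit_in.
move=> x y Yx Yy /= eqo; apply/eqP; rewrite -injY // eqo.
exact: orbit_refl.
Qed.

(** Right cosets, since actions are right actions here; they yield an action
    on the disjoint union of the coset spaces of the members of a
    collection. *)
Definition coset_translate (p : {group gT} * {set gT}) (g : gT) :=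
  (p.1, p.2 :* g).

Fact coset_translate1 : coset_translate^~ 1 =1 id.
Proof. by case=> H C; rewrite /coset_translate rcoset1. Qed.

Fact coset_translateM p : act_morph coset_translate p.
Proof. by move=> x y; rewrite /coset_translate rcosetM. Qed.

Canonical coset_translation :=
  TotalAction coset_translate1 coset_translateM.

Definition cosets_of HH : {set {group gT} * {set gT}} :=
  [set p | (p.1 \in HH) && (p.2 \in rcosets p.1 G)].

Lemma card_cosets_of HH : #|cosets_of HH| = collection_degree G HH.
Proof.
rewrite -sum1_card (eq_bigl (fun p => (p.1 \in HH) && (p.2 \in rcosets p.1 G))).
  rewrite -(pair_big_dep (mem HH) (fun H C => C \in rcosets H G) (fun _ _ => 1%N)) /=.
  by apply: eq_bigr => H _; rewrite sum1_card.
by move=> p; rewrite inE.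
Qed.

Lemma collection_action HH : faithful_collection G HH ->
  has_faithful_action G (collection_degree G HH).
Proof.
case=> collHH coreHH; pose S := cosets_of HH.
have sGdom : G \subset subact_dom (mem S) coset_translation.
  apply/subsetP=> g Gg; rewrite inE in_setT inE; apply/subsetP=> -[H C].
  rewrite !inE /= => /andP[-> /rcosetsP[x Gx ->]] /=; apply/rcosetsP.
  by exists (x * g); rewrite ?groupM ?rcosetM.
pose to := raction (subaction {p | p \in S} coset_translation) sGdom.
exists {p | p \in S}, to; split; first by rewrite card_sig card_cosets_of.
rewrite /faithful -coreHH; apply/subsetP=> g /setIP[Gg cg].
rewrite inE Gg; apply/bigcapP=> H HHH; apply/bigcapP=> x Gx.
(* An element that fixes the coset H x lies in the conjugate of H by x. *)
have Hx : (H, H :* x) \in S by rewrite inE HHH; apply/rcosetsP; exists x.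
have /(congr1 val) := astab_act cg (in_setT (exist _ (H, H :* x) Hx)).
rewrite [to _ _]/(subact _ _ _) val_subact (subsetP sGdom g Gg) => -[eqHx].
rewrite mem_conjg conjgE invgK mulgA -mem_rcoset -eqHx.
by rewrite mem_rcoset mulgK rcoset_refl.
Qed.

Lemma min_degree_minimal_faithful HH :
  minimal_faithful_collection G HH -> min_degree G = collection_degree G HH.
Proof.
case=> fHH minHH; rewrite /min_degree; case: ex_minnP => n /asboolP[X [to [<- fto]]] minn.
apply/eqP; rewrite eqn_leq minn /=; last exact/asboolP/collection_action.
have [L fL <-] := stabilizers_faithful fto.
apply: leq_trans (collection_degree_set L); apply: minHH.
by apply/(@faithful_collection_set L) => // K; rewrite inE.
Qed.

End Degrees.

(** * Runs of the greedy construction *)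

Section GreedyRuns.

Variables (gT : finGroupType) (G : {group gT}).
Implicit Types (H K T : {group gT}) (L : seq {group gT}) (HH : {set {group gT}}).
Implicit Types (s : nat -> greedy_state gT).

(** The state reached by choosing the members of L in turn, whether or not these
    choices are greedy. *)
Definition run L : greedy_state gT := foldl (greedy_next G) (greedy_init G) L.

Lemma run_rcons L H : run (rcons L H) = greedy_next G (run L) H.
Proof. by rewrite /run foldl_rcons. Qed.

Lemma run_coll L : greedy_coll (run L) = [set K in L].
Proof.
elim/last_ind: L => [|L H IHL]; first by apply/setP=> K; rewrite !inE.
by rewrite run_rcons /= IHL; apply/setP=> K; rewrite !inE mem_rcons.
Qed.

Lemma run_top L : greedy_top (run L) = (socle G :&: seq_core G L)%G.
Proof.
apply: group_inj; elim/last_ind: L => [|L H IHL] /=.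
  by rewrite /seq_core big_nil setIT.
by rewrite run_rcons /= IHL -cats1 seq_core_cat seq_core_cons /seq_core big_nil setIT setIA.
Qed.

Lemma run_weight L : all (fun K => K \subset G) L ->
  greedy_weight (run L) = ((seq_degree G L)%:R / #|G|%:R)%R :> rat.
Proof.
elim/last_ind: L => [|L H IHL]; first by rewrite /seq_degree big_nil GRing.mul0r.
rewrite all_rcons => /andP[sHG /IHL]; rewrite run_rcons /= => ->.
rewrite -cats1 seq_degree_cat seq_degree_cons /seq_degree big_nil addn0 GRing.natrD GRing.mulrDl.
congr (_ + _)%R; rewrite -(Lagrange sHG) mulnC GRing.natrM GRing.invfM GRing.mulrA.
by rewrite GRing.mulfV ?GRing.mul1r // Num.Theory.pnatr_eq0 -lt0n indexg_gt0.
Qed.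

Lemma run_top_socle_normals L : all (fun K => K \subset G) L ->
  greedy_top (run L) \in socle_normals G.
Proof.
move=> sLG; rewrite run_top; have nsS := socle_normal G.
apply/socle_normalsP; split; last exact: subsetIl.
rewrite /= -(setIidPl (normal_sub nsS)) -setIA normalI //.
exact: normal_seq_core.
Qed.

Lemma seq_faithful_run L1 L2 : all (fun K => K \subset G) L1 ->
  seq_faithful G (greedy_top (run L1)) L2 = seq_faithful G (socle G) (L1 ++ L2).
Proof.
by move=> sL1; rewrite /seq_faithful run_top all_cat sL1 seq_core_cat setIA.
Qed.

Lemma run_top_notin L H :
  ~~ (greedy_top (run L) \subset H) -> all (fun K => K \subset G) L -> H \notin L.
Proof.
move=> nsTH sLG; apply: contra nsTH => LH; rewrite run_top /=.
apply: subset_trans (subsetIr _ _) _; apply/subsetP=> x /seq_coreP/(_ H LH).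
exact: (subsetP (gcore_sub H G)).
Qed.

Hypothesis friendlyG : socle_friendly G.

Lemma exchange_degree T H L L' : greedy_choice G T H ->
    all (fun K => K \subset G) L -> exchange_result G T H L L' ->
  (#|G : H| + seq_degree G L' <= seq_degree G L)%N.
Proof.
case=> sHG _ maxH /allP sLG [[K /andP[LK nsTK] ->] | [] //].
by have sKG := sLG K LK; rewrite leq_add2r -leq_index ?maxH.
Qed.

(** The last clause is the optimality invariant: every faithful list can be
    exchanged, at no extra cost, into one that extends the current choices. *)
Lemma greedy_sequence_run s i : greedy_sequence G s -> (i <= group_dim G)%N ->
  exists L, [/\ s i = run L, [/\ size L = i, uniq L & all (fun K => K \subset G) L],
    height G (greedy_top (s i)) = (group_dim G - i)%N
    & forall L0, seq_faithful G (socle G) L0 ->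
        exists2 L', seq_faithful G (greedy_top (s i)) L'
          & (seq_degree G L + seq_degree G L' <= seq_degree G L0)%N].
Proof.
case=> s0 sS; elim: i => [_ | i IHi lti].
  exists [::]; rewrite s0; split=> //; first by rewrite group_dimE subn0.
  by move=> L0 fL0; exists L0; rewrite // /seq_degree big_nil.
have [L [def_si [szL uL sLG] hi opt]] := IHi (ltnW lti).
have sT := run_top_socle_normals sLG; rewrite -def_si in sT.
have := sS i; rewrite /greedy_step -(height_eq0 sT) hi subn_eq0 leqNgt lti /=.
case=> H gH def_s; have [sHG nsTH _] := gH; exists (rcons L H).
split; first by rewrite run_rcons -def_si.
- rewrite size_rcons szL rcons_uniq uL all_rcons sHG sLG; split=> //.
  by rewrite run_top_notin // -def_si.
- by rewrite subnS -hi (height_greedy friendlyG sT gH) def_s.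
move=> L0 /opt[L1 fL1 leL1].
have [L' fL' ex] := greedy_exchange friendlyG sT gH fL1.
exists L'; first by rewrite def_s.
apply: leq_trans leL1; rewrite -cats1 seq_degree_cat seq_degree_cons.
rewrite {2}/seq_degree big_nil addn0 -addnA leq_add2l.
by apply: exchange_degree gH _ ex; case/andP: fL1.
Qed.

Lemma greedy_sequence_minimal s : greedy_sequence G s ->
  [/\ ((0 < group_dim G)%N -> greedy_top (s (group_dim G).-1) :!=: 1),
      greedy_top (s (group_dim G)) :=: 1,
      minimal_faithful_collection G (greedy_coll (s (group_dim G))),
      #|greedy_coll (s (group_dim G))| = group_dim G
    & greedy_weight (s (group_dim G)) = relative_min_degree G].
Proof.
move=> gs; have [L [def_s [szL uL sLG] hs opt]] := greedy_sequence_run gs (leqnn _).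
have sT := run_top_socle_normals sLG; rewrite -def_s in sT.
have T1 : greedy_top (s (group_dim G)) :=: 1.
  by apply/eqP; rewrite -(height_eq0 sT) hs subnn.
have collE : L =i greedy_coll (s (group_dim G)).
  by move=> K; rewrite def_s run_coll inE.
have minL : minimal_faithful_collection G (greedy_coll (s (group_dim G))).
  apply: (minimal_faithful_collectionP G collE uL).2; split=> [|L0 /opt[L' _]].
    by rewrite /seq_faithful sLG -T1 def_s run_top /=.
  exact: leq_trans (leq_addr _ _).
split=> //.
- move=> dim_gt0; have [L1 [def_s1 [_ _ sL1] h1 _]] := greedy_sequence_run gs (leq_pred _).
  have sT1 := run_top_socle_normals sL1; rewrite -def_s1 in sT1.
  by rewrite -(height_eq0 sT1) h1 -subn1 subKn.
- by rewrite def_s run_coll cardsE (card_uniqP uL).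
rewrite /relative_min_degree (min_degree_minimal_faithful minL) def_s run_weight // run_coll.
congr (_%:R / _)%R; rewrite /collection_degree /seq_degree (big_uniq _ uL) /=.
by apply: eq_bigl => K; rewrite inE.
Qed.

(** A larger legal choice H at stage i would improve on L by an exchange, or
    turn L into an equally cheap faithful list with more than dim G members;
    the height of the socle does not allow the latter to be minimal. *)
Lemma sorted_greedy HH L i :
    minimal_faithful_collection G HH -> #|HH| = group_dim G ->
    L =i HH -> uniq L -> sorted (fun H K => #|K| <= #|H|)%N L ->
    (i < size L)%N ->
  greedy_choice G (greedy_top (run (take i L))) (nth 1%G L i).
Proof.
move=> minHH cardHH eqL uL srtL lti.
have [fL minL] := (minimal_faithful_collectionP G eqL uL).1 minHH.
have szL : size L = group_dim G.
  by rewrite -cardHH -(card_uniqP uL); apply: eq_card.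
set K := nth _ L i; set L1 := take i L; pose L2 := drop i L.
have defL2 : L2 = K :: drop i.+1 L by rewrite /L2 (drop_nth 1%G).
have defL : L = L1 ++ L2 by rewrite cat_take_drop.
have sLG : all (fun K => K \subset G) L by case/andP: fL.
have [sL1 sL2] : all (fun K => K \subset G) L1 /\ all (fun K => K \subset G) L2.
  by apply/andP; rewrite -all_cat -defL.
have sKG : K \subset G by apply: (allP sLG); rewrite mem_nth.
have sT := run_top_socle_normals sL1; set T := greedy_top _ in sT *.
have [nsT _] := socle_normalsP _ _ sT.
have fL2 : seq_faithful G T L2 by rewrite seq_faithful_run -?defL.
have degL : seq_degree G L = (seq_degree G L1 + seq_degree G L2)%N.
  by rewrite defL seq_degree_cat.
have nsTK : ~~ (T \subset K).
  apply/negP=> sTK; have := minL (L1 ++ drop i.+1 L).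
  rewrite -seq_faithful_run // degL seq_degree_cat leq_add2l defL2 seq_degree_cons.
  rewrite leqNgt -[X in (X < _)%N]add0n ltn_add2r indexg_gt0 => /(_ _)/negP[] //.
  by move: fL2; rewrite defL2 seq_faithful_cons /seq_faithful /= capI_gcore // => /andP[].
split=> // K1 sK1G nsTK1; rewrite leqNgt; apply/negP=> ltKK1.
pose P := [pred H : {group gT} | (H \subset G) && ~~ (T \subset H)].
have PK : P K by rewrite /= sKG.
have [H /andP[sHG nsTH] maxH] := arg_maxnP (fun H : {group gT} => #|H|) PK.
have gH : greedy_choice G T H by split=> // K2 sK2G nsTK2; apply: maxH; rewrite /= sK2G.
have ltKH : (#|K| < #|H|)%N.
  by apply: leq_trans ltKK1 _; apply: maxH; rewrite /= sK1G.
have [L' fL' ex] := greedy_exchange friendlyG sT gH fL2.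
have fLH : seq_faithful G (socle G) (L1 ++ H :: L').
  by rewrite -seq_faithful_run // seq_faithful_cons sHG.
have degLH : seq_degree G (L1 ++ H :: L') =
    (seq_degree G L1 + (#|G : H| + seq_degree G L'))%N.
  by rewrite seq_degree_cat seq_degree_cons.
case: ex => [[K2 /andP[L2K2 nsTK2] degL2] | [szL' leL']].
  have sK2G := allP sL2 _ L2K2.
  have := minL _ fLH; rewrite degLH degL leq_add2l degL2 leq_add2r.
  rewrite -leq_index // leqNgt => /negP; apply; apply: leq_ltn_trans ltKH.
  have := drop_sorted i srtL; rewrite -/L2 defL2 /=.
  rewrite path_sortedE => [/andP[/allP le_K _] | x y z lexy leyz]; last exact: leq_trans leyz lexy.
  by move: L2K2; rewrite defL2 inE => /predU1P[-> //|/le_K].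
have [leLH | [L3 fL3 ltL3]] := faithful_or_height (socle_in_socle_normals G) fLH.
  have szE : size L = (size L1 + size L2)%N by rewrite -size_cat -defL.
  by move: leLH; rewrite -group_dimE -szL szE size_cat /= szL' addnS ltnn.
have := leq_ltn_trans (minL _ fL3) ltL3.
by rewrite degLH degL ltn_add2l ltnNge leL'.
Qed.

Lemma G_isomorphic_refl HH : G_isomorphic G HH HH.
Proof. by exists id; split=> //; rewrite imset_id. Qed.

Lemma minimal_greedy_sequence HH :
    minimal_faithful_collection G HH -> #|HH| = group_dim G ->
  exists2 s : nat -> greedy_state gT,
    greedy_sequence G s & G_isomorphic G (greedy_coll (s (group_dim G))) HH.
Proof.
move=> minHH cardHH.
pose L := sort (fun H K => #|K| <= #|H|)%N (enum HH).
have eqL : L =i HH by move=> K; rewrite mem_sort mem_enum.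
have uL : uniq L by rewrite sort_uniq enum_uniq.
have srtL : sorted (fun H K => #|K| <= #|H|)%N L.
  by apply: sort_sorted => H K; apply: leq_total.
have szL : size L = group_dim G by rewrite size_sort -cardE.
have [/andP[sLG tiL] _] := (minimal_faithful_collectionP G eqL uL).1 minHH.
exists (fun i => run (take i L)); last first.
  rewrite -szL take_size run_coll; have -> : [set K in L] = HH.
    by apply/setP=> K; rewrite inE eqL.
  exact: G_isomorphic_refl.
split=> [|i]; first by rewrite take0.
have [lti | lei] := ltnP i (size L); last first.
  rewrite !take_oversize ?(leq_trans lei) // /greedy_step run_top /=.
  by rewrite tiL.
have gL := sorted_greedy minHH cardHH eqL uL srtL lti.
rewrite /greedy_step ifF; last first.
  case: gL => _ nsT _; apply: contraNF nsT => /eqP->; exact: sub1G.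
by exists (nth 1%G L i); rewrite // (take_nth 1%G) // run_rcons.
Qed.

End GreedyRuns.

Theorem theorem3p16 (gT : finGroupType) (G : {group gT}) :
  socle_friendly G ->
  (forall s : nat -> greedy_state gT, greedy_sequence G s ->
    [/\ ((0 < group_dim G)%N -> greedy_top (s (group_dim G).-1) :!=: 1),
        greedy_top (s (group_dim G)) :=: 1,
        minimal_faithful_collection G (greedy_coll (s (group_dim G))),
        #|greedy_coll (s (group_dim G))| = group_dim G
      & greedy_weight (s (group_dim G)) = relative_min_degree G]) /\
  (forall HH : {set {group gT}},
    minimal_faithful_collection G HH -> #|HH| = group_dim G ->
    exists2 s : nat -> greedy_state gT,
      greedy_sequence G s & G_isomorphic G (greedy_coll (s (group_dim G))) HH).
Proof.
move=> friendlyG; split; first exact: greedy_sequence_minimal.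
exact: minimal_greedy_sequence.
Qed.
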